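(* Let $b\ge2$. For all $n\ge2$, $$\min_{1\le j\le n-1}\big(K_i(j)+K_{-i-2}(n-j)\big)=K'_i(n)\quad\text{for all } i\in I,$$ and $$B(n)=\hat B(n).$$ Furthermore, for all $n\ge3$, $B(n)\ge B(n-1)+1$ if $b$ is odd and $n\in\{3,4\}$, and $B(n)\ge B(n-1)+2$ otherwise.
   Context: Fix a base $b\ge2$. For $v\in\mathbb{N}$, $s(v)$ is the sum of the base-$b$ digits of $v$, $f(v)=v+s(v)$, and $F(u)=|\{v\in\mathbb{N}: f(v)=u\}|$. $K(n)$ is the smallest $u\in\mathbb{N}$ with $F(u)=n$, and for $n\ge2$, $B(n)=\lfloor\log_b K(n)\rfloor$. The index set $I$ is the set of residue classes modulo $b-1$ if $b$ is even, and the set of even residue classes $\{0,2,\dots,b-3\}$ modulo $b-1$ if $b$ is odd; subscripts are read modulo $b-1$. For $i\in I$, $K_i(n)$ is the smallest $u\in\mathbb{N}$ with $F(u)=n$ and $u\equiv i\pmod{b-1}$. For $n\ge2$ and $i\in I$ define $$K'_i(n)=\min\{K_i(\lceil n/2\rceil)+K_{-i-2}(\lfloor n/2\rfloor),\ K_i(\lfloor n/2\rfloor)+K_{-i-2}(\lceil n/2\rceil)\}$$ and $$\hat B(n)=\frac{\min_{i\in I}K'_i(n)+2}{b-1}.$$ *)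

(* Defs.v *)
From mathcomp Require Import all_boot all_order all_algebra finmap zify ring.
From mathcomp Require Import boolp classical_sets functions cardinality.

Set Implicit Arguments.
Unset Strict Implicit.
Unset Printing Implicit Defensive.

Local Open Scope classical_set_scope.
Local Open Scope nat_scope.

(* Here nat contains 0: F b 0 = 1 (with v = 0) and K b 1 = 0. *)

(* For 2 <= b we have v < b ^ v, so every digit in position k >= v is 0. *)
Definition digit_sum (b v : nat) : nat := \sum_(k < v) ((v %/ b ^ k) %% b).

Definition f (b v : nat) : nat := v + digit_sum b v.

(* fset_set is faithful here because the set is finite, see finite_fiber. *)
Definition F (b u : nat) : nat := #|` fset_set [set v | f b v = u]|.

(* Equal to 0 when A is empty. This default is never reached in the
   definitions below, see exists_K, exists_Ki and exists_I. *)
Definition nat_min (A : set nat) : nat :=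
  xget 0 [set u | A u /\ forall v, A v -> u <= v].

Definition K (b n : nat) : nat := nat_min [set u | F b u = n].

(* A residue class modulo b - 1 is given by any integer i in it. *)
Definition Ki (b : nat) (i : int) (n : nat) : nat :=
  nat_min [set u : nat | F b u = n /\ (u = i %[mod (b%:Z - 1)%R])%Z].

(* One representative in {0, ..., b - 2} for each class. *)
Definition I (b : nat) : set nat :=
  [set i | i < b - 1 /\ (odd b -> ~~ odd i)].

Definition K' (b : nat) (i : int) (n : nat) : nat :=
  minn (Ki b i (uphalf n) + Ki b (- i - 2)%R n./2)
       (Ki b i n./2 + Ki b (- i - 2)%R (uphalf n)).

Definition B (b n : nat) : nat := trunc_log b (K b n).

(* The quotient is taken in rat: that it is an integer is not built in. *)
Definition Bhat (b n : nat) : rat :=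
  ((nat_min [set K' b i%:Z n | i in I b] + 2)%N%:R / (b - 1)%N%:R)%R.

Lemma nat_minP (A : set nat) : A !=set0 ->
  A (nat_min A) /\ forall v, A v -> nat_min A <= v.
Proof.
move=> [x Ax]; rewrite /nat_min.
have exA : exists m, `[< A m >] by exists x; apply/asboolP.
have [m /asboolP Am minm] := ex_minnP exA.
apply: (@xgetPex _ 0 [set u | A u /\ forall v, A v -> u <= v]).
by exists m; split=> // v Av; apply: minm; apply/asboolP.
Qed.

Lemma digit_sum_bound b v N : 1 < b -> v <= N ->
  digit_sum b v = \sum_(k < N) (v %/ b ^ k) %% b.
Proof.
move=> b1 vN; rewrite /digit_sum -!(big_mkord xpredT (fun k => (v %/ b ^ k) %% b)).
rewrite (@big_cat_nat _ _ _ v 0 N) //=.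
have -> : \sum_(v <= k < N) (v %/ b ^ k) %% b = 0; last by rewrite addn0.
rewrite big_nat_cond big1 // => k; rewrite andbT => /andP[vk _].
by rewrite divn_small ?mod0n //; apply: leq_ltn_trans vk _; apply: ltn_expl.
Qed.

Lemma digit_sum_rec b q r : 1 < b -> r < b ->
  digit_sum b (q * b + r) = r + digit_sum b q.
Proof.
move=> b1 rb; have b0 : 0 < b by lia.
rewrite (@digit_sum_bound b _ (q * b + r).+1) // big_ord_recl /= expn0 divn1.
rewrite modnMDl modn_small //; congr (_ + _).
rewrite (@digit_sum_bound b q (q * b + r)) //; last by nia.
by apply: eq_bigr => k _; rewrite expnS divnMA divnMDl // (divn_small rb) addn0.
Qed.

Lemma digit_sum0 b : digit_sum b 0 = 0.
Proof. by rewrite /digit_sum big_ord0. Qed.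

Lemma digit_sum_digit b r : 1 < b -> r < b -> digit_sum b r = r.
Proof.
by move=> b1 rb; rewrite -[r in LHS]add0n -[X in X + _](mul0n b) digit_sum_rec // digit_sum0 addn0.
Qed.

Lemma digit_sum_compl b k v : 1 < b -> v < b ^ k ->
  digit_sum b (b ^ k - 1 - v) + digit_sum b v = k * (b - 1).
Proof.
move=> b1; elim: k v => [|k IH] v.
  by rewrite expn0 ltnS leqn0 => /eqP ->; rewrite digit_sum0.
rewrite expnS => vk.
have rb : v %% b < b by rewrite ltn_mod; lia.
have qk : v %/ b < b ^ k by rewrite ltn_divLR; lia.
have ev := divn_eq v b; move: (v %/ b) (v %% b) rb qk ev => q r rb qk ev.
have IHq := IH q qk.
have -> : b * b ^ k - 1 - v = (b ^ k - 1 - q) * b + (b - 1 - r).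
  rewrite ev; move: (b ^ k) qk => M qk.
  have -> : M = (M - 1 - q) + q.+1 by lia.
  move: (M - 1 - q) => p; have -> : p + q.+1 - 1 - q = p by lia.
  by rewrite mulnDr mulnS [p * b]mulnC [q * b]mulnC; lia.
by rewrite ev !digit_sum_rec //; lia.
Qed.

Lemma digit_sum_lead b k v : 1 < b -> v < b ^ k ->
  digit_sum b (b ^ k + v) = (digit_sum b v).+1.
Proof.
move=> b1; elim: k v => [|k IH] v.
  rewrite expn0 ltnS leqn0 => /eqP ->; rewrite addn0 digit_sum0.
  by rewrite digit_sum_digit.
rewrite expnS => vk.
have rb : v %% b < b by rewrite ltn_mod; lia.
have qk : v %/ b < b ^ k by rewrite ltn_divLR; lia.
have ev := divn_eq v b; move: (v %/ b) (v %% b) rb qk ev => q r rb qk ev.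
have -> : b * b ^ k + v = (b ^ k + q) * b + r by rewrite ev; nia.
by rewrite ev !digit_sum_rec // IH //; lia.
Qed.

Lemma fiberE b u N : u < N ->
  [set v | f b v = u] = [set` [fset v in [seq v <- iota 0 N | f b v == u]]%fset].
Proof.
move=> uN; apply/seteqP; split=> v /=; rewrite !inE /= mem_filter mem_iota add0n /=.
  by move=> fv; rewrite fv eqxx /=; apply: leq_ltn_trans uN; rewrite -fv leq_addr.
by case/andP => /eqP.
Qed.

Lemma finite_fiber b u : finite_set [set v | f b v = u].
Proof. by rewrite (fiberE b (ltnSn u)); apply: finite_fset. Qed.

Lemma F_count b u N : u < N -> F b u = count (fun v => f b v == u) (iota 0 N).
Proof.
move=> uN; rewrite /F (fiberE b uN) set_fsetK card_fseq undup_id ?size_filter //.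
by rewrite filter_uniq // iota_uniq.
Qed.

Lemma F_junction b k a c : 1 < b -> a + c + 2 = k * (b - 1) ->
  F b (b ^ k + 1 + a) = F b a + F b c.
Proof.
move=> b1 ack.
have kb : k * (b - 1) < b ^ k.
  elim: k {ack} => [|k IH]; first by rewrite expn0.
  by rewrite expnS; nia.
set M := b ^ k in kb *.
rewrite (@F_count b _ (M + M)); last by lia.
rewrite iotaD count_cat add0n (@F_count b a M) ?(@F_count b c M); [|lia|lia].
rewrite addnC; congr (_ + _).
  rewrite -[X in iota X _]addn0 iotaDl count_map; apply: eq_in_count => v.
  rewrite mem_iota add0n /= => vM.
  by rewrite /f digit_sum_lead //; lia.
have cnt (P : pred nat) : count P (iota 0 M) = \sum_(i < M) (P i : nat).
  rewrite -sum1_count big_mkcond -(big_mkord xpredT (fun i => P i : nat)).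
  by rewrite /index_iota subn0; apply: eq_bigr => i _; case: (P i).
rewrite !cnt (reindex_inj rev_ord_inj); apply: eq_bigr => i _; congr nat_of_bool.
have iM := ltn_ord i; have := digit_sum_compl b1 iM.
by rewrite /f /= -/M -subnDA add1n; lia.
Qed.

Lemma F_even b v : 1 < b -> v < b -> v.*2 <= b \/ ~~ odd b ->
  F b v.*2 = 1.
Proof.
move=> b1 vb hb; rewrite (@F_count b _ b.*2); last by lia.
rewrite (@eq_in_count _ _ (pred1 v)).
  by rewrite count_uniq_mem ?iota_uniq // mem_iota; lia.
move=> w; rewrite mem_iota add0n /= => wb.
have [wlt|wge] := ltnP w b.
  by rewrite /f digit_sum_digit //; lia.
have ew : w = 1 * b + (w - b) by lia.
rewrite /f {2}ew digit_sum_rec ?(digit_sum_digit b1 b1); [|lia|lia].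
by case: hb => hb; lia.
Qed.

Lemma F1_class b (i : int) : 1 < b -> (odd b -> (2 %| i)%Z) ->
  exists u : nat, F b u = 1 /\ (u = i %[mod (b%:Z - 1)%R])%Z.
Proof.
move=> b1 ib.
pose r := `|(i %% (b%:Z - 1)%R)%Z|%N.
have rE : (r%:Z = (i %% (b%:Z - 1)%R)%Z)%R by rewrite /r; lia.
have rb : r < b - 1 by lia.
have ri : (r = i %[mod (b%:Z - 1)%R])%Z by rewrite rE modz_mod.
case: (boolP (odd r)) => orr; last first.
  exists r; split=> //.
  have -> : r = r./2.*2 by lia.
  by apply: F_even => //; lia.
have evb : ~~ odd b.
  apply/negP => ob; have /dvdzP[q iq] := ib ob.
  have := divz_eq i (b%:Z - 1)%R; rewrite -rE.
  set t := (_ %/ _)%Z => e.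
  have eb' : (b%:Z - 1 = b./2%:Z * 2)%R by lia.
  by move: e; rewrite iq eb' GRing.mulrA; lia.
exists (r + (b - 1)); split.
  have -> : r + (b - 1) = (r + (b - 1))./2.*2 by lia.
  by apply: F_even => //; [lia|right].
have -> : ((r + (b - 1))%:Z = r%:Z + (b%:Z - 1))%R by lia.
by rewrite modzDr.
Qed.

Lemma F_class b n (i : int) : 1 < b -> 0 < n -> (odd b -> (2 %| i)%Z) ->
  exists u : nat, F b u = n /\ (u = i %[mod (b%:Z - 1)%R])%Z.
Proof.
move=> b1; case: n => // n _.
elim: n i => [|n IH] i ib; first exact: F1_class.
have [|a [Fa ai]] := @F1_class b (i - 2)%R b1; first by move/ib; lia.
have [|c [Fc ci]] := IH (- i)%R; first by move/ib; lia.
have /dvdzP[p ep] : ((b%:Z - 1)%R %| (a%:Z - (i - 2))%R)%Z by rewrite -eqz_mod_dvd ai.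
have /dvdzP[q eq] : ((b%:Z - 1)%R %| (c%:Z - (- i))%R)%Z by rewrite -eqz_mod_dvd ci.
have eb : (b%:Z - 1 = (b - 1)%N%:Z)%R by lia.
have : ((b%:Z - 1)%R %| Posz (a + c + 2))%Z.
  by apply/dvdzP; exists (p + q)%R; lia.
rewrite {1}eb => /dvdnP[k ack].
exists (b ^ k + 1 + a); split; first by rewrite (F_junction b1 ack) Fa Fc; lia.
have /dvdzP[t et] : ((b%:Z - 1)%R %| ((b ^ k)%N%:Z - 1)%R)%Z.
  elim: (k) => [|m /dvdzP[t et]]; first by rewrite expn0.
  apply/dvdzP; exists (b%:Z * t + 1)%R; rewrite expnS PoszM.
  move: (b ^ m) et => M et; have -> : (M%:Z = t * (b%:Z - 1) + 1)%R by lia.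
  by change int in t; ring.
by apply/eqP; rewrite eqz_mod_dvd; apply/dvdzP; exists (t + p)%R; lia.
Qed.

Lemma exists_Ki b n (i : int) : 1 < b -> 0 < n -> (odd b -> (2 %| i)%Z) ->
  [set u : nat | F b u = n /\ (u = i %[mod (b%:Z - 1)%R])%Z] !=set0.
Proof. exact: F_class. Qed.

Lemma exists_K b n : 1 < b -> 0 < n -> [set u | F b u = n] !=set0.
Proof. by move=> b1 n0; have [|u [Fu _]] := @F_class b n 0%R b1 n0; [|exists u]. Qed.

Lemma exists_I b : 1 < b -> I b !=set0.
Proof. by move=> b1; exists 0; split=> //=; rewrite subn_gt0. Qed.

(* Main.v *)
(* If F(u) >= 2, let m be the highest digit position at which two elements of
   the fiber of u differ. Then the whole fiber lies in two adjacent blocks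
   [D b^m, (D+1) b^m) and [(D+1) b^m, (D+2) b^m), and v |-> b^m - 1 - v on the
   lower one turns F(u) into F(a) + F(c) with a + c + 2 = m (b - 1). Conversely
   any such pair is realized with a one-digit D + 1. Hence B(n) (b - 1) is the
   minimum of a + c + 2 over F(a) + F(c) = n, that is, of
   K_i(j) + K_{-i-2}(n-j) + 2. Moreover b^B(n) <= K_i(n), and K_i(n) < b^(B(n)+1)
   because a leading digit can be chosen to reach any class i.
   If K_i(j) - K_i(j-1) >= e (b - 1), replacing the larger part j of an optimal
   pair for n by j - 1 gives B(n) >= B(n-1) + e; in turn the growth of B makes
   K_i(j) at least twice every K_i'(j-1), which by induction yields both the
   growth of B and the optimality of the balanced pair. Odd b >= 5 needs explicit
   bounds on K_i(2) and K_i(3), since there B(3) and B(4) may grow by 1 only. *)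

Require Import Defs.
From mathcomp Require Import all_boot all_order all_algebra zify.
From mathcomp Require Import boolp classical_sets.

Local Open Scope classical_set_scope.
Local Open Scope nat_scope.

Section Junctions.
Variable b : nat.
Hypothesis b1 : 1 < b.

(** * Digit sums and linear bounds on powers of b *)

Lemma digit_sum_split m D v : v < b ^ m ->
  digit_sum b (D * b ^ m + v) = digit_sum b D + digit_sum b v.
Proof.
elim: m v => [|m IH] v.
  by rewrite expn0 ltnS leqn0 => /eqP ->; rewrite muln1 addn0 digit_sum0 addn0.
rewrite expnS => vm.
have rb : v %% b < b by rewrite ltn_mod; lia.
have qm : v %/ b < b ^ m by rewrite ltn_divLR; lia.
have ev := divn_eq v b; move: (v %/ b) (v %% b) rb qm ev => q r rb qm ev.
have -> : D * (b * b ^ m) + v = (D * b ^ m + q) * b + r by rewrite ev; lia.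
by rewrite ev !digit_sum_rec // IH //; lia.
Qed.

Lemma digit_sum_succ D : ~~ (b %| D.+1) -> digit_sum b D.+1 = (digit_sum b D).+1.
Proof.
move=> bD; have b0 : 0 < b by lia.
have rb : D.+1 %% b < b by rewrite ltn_mod.
have r0 : 0 < D.+1 %% b by rewrite lt0n.
have ev := divn_eq D.+1 b.
move: (D.+1 %/ b) (D.+1 %% b) rb r0 ev => q r rb r0 ev.
have -> : D = q * b + r.-1 by lia.
have -> : (q * b + r.-1).+1 = q * b + r by lia.
by rewrite !digit_sum_rec //; lia.
Qed.

Lemma digit_sum_le m v : v < b ^ m -> digit_sum b v <= m * (b - 1).
Proof. by move=> /(digit_sum_compl b1) <-; exact: leq_addl. Qed.

(** Modulo 2 an odd base acts as 1; hence [f] has only even values. *)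
Lemma odd_digit_sum v : odd b -> odd (digit_sum b v) = odd v.
Proof.
move=> ob; elim/ltn_ind: v => v IH.
case: (posnP v) => [->|v0]; first by rewrite digit_sum0.
have rb : v %% b < b by rewrite ltn_mod; lia.
have qv : v %/ b < v by rewrite ltn_Pdiv.
rewrite [v in LHS](divn_eq v b) digit_sum_rec // [v in RHS](divn_eq v b).
by rewrite !oddD oddM ob andbT IH // addbC.
Qed.

(** Keeps a and c below b^m when a + c + 2 = m (b - 1), so each of their fibers fits in one
    block. *)
Lemma ltn_linear_expn m : m * (b - 1) < b ^ m.
Proof. by elim: m => [|m IH]; rewrite ?expn0 ?expnS; nia. Qed.

Lemma linear_expn m : 1 < m -> m.+1 * (b - 1) <= b ^ m.
Proof.
elim: m => // -[|m] IH // _; have [m0|] := posnP m; first by rewrite m0 expnS expn1; nia.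
by rewrite expnS => m0; have := IH m0; nia.
Qed.

(** * Fibers of [f] and their splitting over two adjacent blocks *)

Lemma F_gt0P u : reflect (exists v, f b v = u) (0 < F b u).
Proof.
rewrite (F_count b (ltnSn u)) -has_count.
apply: (iffP hasP) => [[v _ /eqP]|[v <-]]; first by exists v.
by exists v; rewrite ?eqxx // mem_iota /f; lia.
Qed.

Lemma F_gt1 u : 1 < F b u -> exists v w, [/\ v < w, f b v = u & f b w = u].
Proof.
rewrite (F_count b (ltnSn u)) -size_filter; set s := filter _ _ => s2.
have fs i : i < size s -> f b (nth 0 s i) = u.
  by move=> /(mem_nth 0); rewrite mem_filter => /andP[/eqP].
have su : uniq s by rewrite filter_uniq // iota_uniq.
have := nth_uniq 0 (ltnW s2) s2 su.
case: (ltngtP (nth 0 s 0) (nth 0 s 1)) => // l _.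
  by exists (nth 0 s 0), (nth 0 s 1); rewrite l !fs // ltnW.
by exists (nth 0 s 1), (nth 0 s 0); rewrite l !fs // ltnW.
Qed.

Lemma F_gt0_even u : odd b -> 0 < F b u -> ~~ odd u.
Proof. by move=> ob /F_gt0P[v <-]; rewrite /f oddD odd_digit_sum // addbb. Qed.

(** In the upper block, v = (D+1) b^m + x turns f(v) = u into f(x) = a. In the lower one, v = D b^m
    + (b^m - 1 - y) turns it into f(y) = c, by digit complement and s(D+1) = s(D) + 1. *)
Lemma F_window m D a c : ~~ (b %| D.+1) -> a + c + 2 = m * (b - 1) ->
  (forall v, f b v = D.+1 * b ^ m + digit_sum b D.+1 + a ->
     D * b ^ m <= v < D.+2 * b ^ m) ->
  F b (D.+1 * b ^ m + digit_sum b D.+1 + a) = F b a + F b c.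
Proof.
move=> bD acm; set M := b ^ m; set u := D.+1 * M + _ + a => win.
have mM : m * (b - 1) < M := ltn_linear_expn m.
have sD := digit_sum_succ D bD.
have uN : u < D * M + (M + (M + u.+1)) by lia.
have zero s n : (forall v, s <= v < s + n -> f b v != u) ->
    count (fun v => f b v == u) (iota s n) = 0.
  move=> H; rewrite -(count_pred0 (iota s n)); apply: eq_in_count => v.
  by rewrite mem_iota => /H /negbTE.
rewrite (F_count b uN) !iotaD !count_cat add0n.
rewrite (zero 0) => [|v vl]; last by apply/eqP => /win; lia.
rewrite (zero (D * M + M + M)) => [|v vl]; last by apply/eqP => /win; lia.
rewrite addn0 add0n addnC (@F_count b a M) ?(@F_count b c M); [|lia|lia].
congr (_ + _).
  have -> : D * M + M = D.+1 * M + 0 by lia.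
  rewrite iotaDl count_map; apply: eq_in_count => v.
  by rewrite mem_iota add0n /= => vM; rewrite /f digit_sum_split //; lia.
rewrite -[X in iota X]addn0 iotaDl count_map.
have cnt (P : pred nat) : count P (iota 0 M) = \sum_(i < M) (P i : nat).
  rewrite -sum1_count big_mkcond -(big_mkord xpredT (fun i => P i : nat)).
  by rewrite /index_iota subn0; apply: eq_bigr => i _; case: (P i).
rewrite !cnt (reindex_inj rev_ord_inj); apply: eq_bigr => i _; congr nat_of_bool.
have iM := ltn_ord i; have := digit_sum_compl b1 iM.
rewrite /f /= -/M -subnDA add1n => e.
by rewrite digit_sum_split //; lia.
Qed.

Lemma F_junction_digit m d a c : 1 < m -> 0 < d < b -> a + c + 2 = m * (b - 1) ->
  F b (d * b ^ m + d + a) = F b a + F b c.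
Proof.
case: d => // d m1 db acm; have db' : d.+1 < b by lia.
have bd : ~~ (b %| d.+1) by rewrite gtnNdvd.
have mM := linear_expn m m1.
rewrite -{2}(digit_sum_digit b1 db'); apply: F_window => // v.
rewrite digit_sum_digit // => fv; apply/andP; split; last first.
  by apply: leq_ltn_trans (_ : v <= f b v) _; [exact: leq_addr|rewrite fv; lia].
rewrite leqNgt; apply/negP => vd.
(* Such v has at most m + 1 digits, so s(v) <= (m + 1)(b - 1) <= b^m is too small to reach u. *)
have : v < b ^ m.+1 by rewrite expnS; nia.
by move/digit_sum_le; move: fv; rewrite /f; lia.
Qed.

(** The quotients p < p' by b^m differ only in the last digit, so s(p') - s(p) = p' - p. For the
    remainders x, y of v, w this gives f(x) - f(y) = (p' - p)(b^m + 1), while f(x) < 2 b^m. *)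
Lemma block_gap m v w : f b v = f b w -> v %/ b ^ m.+1 = w %/ b ^ m.+1 ->
  v %/ b ^ m < w %/ b ^ m ->
  w %/ b ^ m = (v %/ b ^ m).+1 /\
  f b (w %% b ^ m) + f b (b ^ m - 1 - v %% b ^ m) + 2 = m * (b - 1).
Proof.
move=> fvw; rewrite !expnSr !divnMA; set M := b ^ m.
have mM : m * (b - 1) < M := ltn_linear_expn m.
have M0 : 0 < M by lia.
have xM : v %% M < M by rewrite ltn_mod.
have yM : w %% M < M by rewrite ltn_mod.
move: fvw; rewrite /f {1 2}(divn_eq v M) {1 2}(divn_eq w M) !digit_sum_split //.
have := digit_sum_compl b1 xM; rewrite -/M.
move: (v %/ M) (w %/ M) (v %% M) (w %% M) xM yM => p p' x y xM yM cx fvw pp' lt.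
have b0 : 0 < b by lia.
have sp q : digit_sum b q = q %% b + digit_sum b (q %/ b).
  by rewrite {1}(divn_eq q b) digit_sum_rec // ltn_mod.
have ep := divn_eq p b; have ep' := divn_eq p' b.
have := sp p; have := sp p'; rewrite -pp' in ep' *.
move: (digit_sum b _) (digit_sum b _) (digit_sum b _) (digit_sum b _)
  (digit_sum b _) cx fvw => ? ? ? ? ? cx fvw sp' spp.
have pE : p' = p.+1 by nia.
by split=> //; subst p'; lia.
Qed.

Lemma F_decomposition u : 1 < F b u -> exists a c m,
  [/\ 0 < F b a, 0 < F b c, F b a + F b c = F b u, a + c + 2 = m * (b - 1)
    & b ^ m <= u].
Proof.
move=> /F_gt1[v0 [w0 [vw0 fv0 fw0]]].
pose P m := `[< exists v w, [/\ f b v = u, f b w = u & v %/ b ^ m < w %/ b ^ m] >].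
have exP : exists m, P m.
  by exists 0; apply/asboolP; exists v0, w0; rewrite expn0 !divn1.
have ubP m : P m -> m <= u.
  move=> /asboolP[v [w [fv fw]]]; apply: contraTT; rewrite -ltnNge => um.
  have : w < b ^ m.
    apply: leq_ltn_trans (ltn_expl m b1); apply: leq_trans (ltnW um).
    by rewrite -fw leq_addr.
  by move=> wm; rewrite (divn_small wm) ltn0.
have [m /asboolP[v [w [fv fw vw]]] maxm] := ex_maxnP exP ubP.
(* Maximality of m puts the whole fiber in one block of length b^(m+1). *)
have same x y : f b x = u -> f b y = u -> x %/ b ^ m.+1 = y %/ b ^ m.+1.
  move=> fx fy; case: (ltngtP (x %/ b ^ m.+1) (y %/ b ^ m.+1)) => // lt.
    have /maxm : P m.+1 by apply/asboolP; exists x, y.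
    by rewrite ltnn.
  have /maxm : P m.+1 by apply/asboolP; exists y, x.
  by rewrite ltnn.
have gap x y : f b x = u -> f b y = u -> x %/ b ^ m < y %/ b ^ m ->
    y %/ b ^ m = (x %/ b ^ m).+1.
  by move=> fx fy /(block_gap m x y (etrans fx (esym fy)) (same x y fx fy))[].
have [wD acm] : _ /\ _ := block_gap m v w (etrans fv (esym fw)) (same v w fv fw) vw.
rewrite /= in wD acm; set M := b ^ m in same gap vw wD acm *.
set D := v %/ M in wD *.
have M0 : 0 < M by rewrite expn_gt0; lia.
have yM : w %% M < M by rewrite ltn_mod.
have uE : u = D.+1 * M + digit_sum b D.+1 + f b (w %% M).
  by rewrite -fw /f {1 2}(divn_eq w M) wD digit_sum_split //; lia.
exists (f b (w %% M)), (f b (M - 1 - v %% M)), m.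
split=> //; [by apply/F_gt0P; eexists|by apply/F_gt0P; eexists| |]; last first.
  by rewrite -/M uE; nia.
rewrite [in RHS]uE; symmetry; apply: F_window => //.
  (* If b divided D + 1, then v and w would lie in different blocks of length b^(m+1). *)
  apply/negP => /dvdnP[[|q] Dq] //.
  have := same v w fv fw; rewrite expnSr !divnMA -/M wD -/D Dq mulnK; last by lia.
  have -> : D = q * b + b.-1 by lia.
  by rewrite divnMDl ?divn_small; lia.
move=> x; rewrite -/M -uE => fx.
have rng : D <= x %/ M < D.+2.
  have [lt|ge] := ltnP (x %/ M) D.+1.
    by have := gap x w fx fw; rewrite wD => /(_ lt) [] <-; lia.
  by have := gap v x fv fx ge; lia.
by rewrite leq_divRL ?ltn_divLR // in rng.
Qed.

(* All values of f are even when b is odd. *)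
Definition admissible (i : int) := odd b -> (2 %| i)%Z.

Lemma admissible_opp i : admissible i -> admissible (- i - 2)%R.
Proof. by move=> ai /ai; lia. Qed.

Lemma admissible_F_gt0 u : 0 < F b u -> admissible u.
Proof. by move=> Fu ob; have := F_gt0_even u ob Fu; lia. Qed.

Lemma admissible_I i : I b i -> admissible i.
Proof. by move=> [_ oi] /oi; lia. Qed.

(** * Residue classes and complementary pairs *)

Lemma KiP i n : 0 < n -> admissible i ->
  [/\ F b (Ki b i n) = n, (b%:Z - 1 %| (Ki b i n)%:Z - i)%Z%R
    & forall u, F b u = n -> (b%:Z - 1 %| u%:Z - i)%Z%R -> Ki b i n <= u].
Proof.
move=> n0 ai; have [[Fk ki] mink] := nat_minP (exists_Ki b1 n0 ai).
split=> //; first by rewrite -eqz_mod_dvd; apply/eqP.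
by move=> u Fu ui; apply: mink; split=> //; apply/eqP; rewrite eqz_mod_dvd.
Qed.

Lemma Ki_class i i' n : (b%:Z - 1 %| i - i')%Z%R -> Ki b i n = Ki b i' n.
Proof. by rewrite -eqz_mod_dvd => /eqP ii; rewrite /Ki ii. Qed.

Lemma Ki_le a : 0 < F b a -> Ki b a (F b a) <= a.
Proof.
move=> Fa; have [_ _ H] := KiP a _ Fa (admissible_F_gt0 a Fa).
by apply: H => //; rewrite GRing.subrr.
Qed.

Lemma dvdz_base m : (b%:Z - 1 %| m)%Z%R = (b - 1 %| `|m|%N).
Proof. by rewrite dvdzE; congr (_ %| _); lia. Qed.

(** The class -i - 2 is the junction condition a + c + 2 = m (b - 1) read modulo b - 1. *)
Lemma complementary a c i : (b%:Z - 1 %| a%:Z - i)%Z%R ->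
  (b%:Z - 1 %| c%:Z - (- i - 2))%Z%R -> exists m, a + c + 2 = m * (b - 1).
Proof.
move=> ai ci; apply/dvdnP; have := GRing.rpredD ai ci.
have -> : (a%:Z - i + (c%:Z - (- i - 2)) = (a + c + 2)%N%:Z)%R by lia.
by rewrite dvdz_base.
Qed.

Lemma complementary_class a c m : a + c + 2 = m * (b - 1) ->
  (b%:Z - 1 %| c%:Z - (- a%:Z - 2))%Z%R.
Proof.
move=> acm; rewrite (_ : _ - _ = (a + c + 2)%N%:Z)%R; last by lia.
by rewrite dvdz_base acm dvdn_mull.
Qed.

(** * [B] as a minimum over complementary pairs *)

Lemma F0 : F b 0 = 1.
Proof. by rewrite (F_count b (ltnSn 0)) /= /f digit_sum0. Qed.

Lemma K_pos n : 1 < n -> 0 < K b n.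
Proof.
move=> n1; have [/= FK _] := nat_minP (exists_K b1 (ltnW n1)).
by rewrite lt0n; apply/eqP => K0; move: FK; rewrite -/(K b n) K0 F0; lia.
Qed.

(** The junction value b^m + 1 + a stays below b^(m+1). *)
Lemma B_le n a c m : 1 < n -> F b a + F b c = n -> a + c + 2 = m * (b - 1) ->
  B b n <= m.
Proof.
move=> n1 Fac acm; have [FK minK] := nat_minP (exists_K b1 (ltnW n1)).
have mb := ltn_linear_expn m.
have Kle : K b n <= b ^ m + 1 + a by apply: minK; rewrite /= (F_junction b1 acm).
rewrite -ltnS -(ltn_exp2l _ _ b1).
apply: leq_ltn_trans (trunc_logP b1 (K_pos n n1)) _.
by apply: leq_ltn_trans Kle _; rewrite expnS; nia.
Qed.

Lemma expn_B_le u : 1 < F b u -> b ^ B b (F b u) <= u.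
Proof.
move=> Fu; have [_ minK] := nat_minP (exists_K b1 (ltnW Fu)).
apply: leq_trans (trunc_logP b1 (K_pos _ Fu)) _.
exact: minK.
Qed.

Lemma expn_B_le_Ki i n : 1 < n -> admissible i -> b ^ B b n <= Ki b i n.
Proof.
move=> n1 ai; have [Fk _ _] := KiP i n (ltnW n1) ai.
by rewrite -{1}Fk; apply: expn_B_le; rewrite Fk.
Qed.

(** Decomposing K(n) gives m with b^m <= K(n), so m <= B(n); [B_le] gives equality. *)
Lemma B_attained n : 1 < n -> exists a c,
  [/\ 0 < F b a, 0 < F b c, F b a + F b c = n & a + c + 2 = B b n * (b - 1)].
Proof.
move=> n1; have [/= FK _] := nat_minP (exists_K b1 (ltnW n1)).
rewrite -/(K b n) in FK.
have [|a [c [m [Fa Fc Fac acm mK]]]] := F_decomposition (K b n); first by rewrite FK.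
rewrite FK in Fac; exists a, c; split=> //.
have -> // : B b n = m; apply/eqP; rewrite eqn_leq (B_le _ _ _ _ n1 Fac acm).
by rewrite /B; apply: trunc_log_max.
Qed.

(** Since d b^m + d is congruent to 2 d modulo b - 1, a leading digit d shifts the class by 2 d. *)
Lemma exists_digit z : admissible z ->
  exists d, 0 < d < b /\ (b%:Z - 1 %| d%:Z * 2 - z)%Z%R.
Proof.
move=> az; have [q] : exists q, (b%:Z - 1 %| q * 2 - z)%Z%R.
  case: (boolP (odd b)) => ob.
    by have /dvdzP[q ->] := az ob; exists q; rewrite GRing.subrr dvdz0.
  (* b/2 inverts 2 modulo b - 1, as 2 (b/2) = b. *)
  exists (z * b./2%:Z)%R; apply/dvdzP; exists z.
  have -> : (b%:Z = b./2%:Z * 2)%R by lia.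
  by rewrite GRing.mulrBr GRing.mulr1 GRing.mulrA.
(* Reducing q - 1 instead of q makes the digit r + 1 nonzero. *)
have := divz_eq (q - 1) (b%:Z - 1)%R; set t := (_ %/ _)%Z; set r := (_ %% _)%Z => e.
have r0 : (0 <= r)%R by apply: modz_ge0; lia.
have rb : (r < b%:Z - 1)%R by apply: ltz_pmod; lia.
move=> /dvdzP[s es]; exists (`|r|.+1)%N; split; first by lia.
by apply/dvdzP; exists (s - t * 2)%R; lia.
Qed.

Lemma dvdz_expn_sub1 k : (b%:Z - 1 %| (b ^ k)%N%:Z - 1)%Z%R.
Proof.
have bk : 0 < b ^ k by rewrite expn_gt0; lia.
rewrite (_ : _ - 1 = (b ^ k - 1)%N%:Z)%R; last by lia.
by rewrite dvdz_base !subn1; exact: dvdn_pred_predX.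
Qed.

Lemma Ki_lt_expn i n : 1 < n -> 1 < B b n -> admissible i ->
  Ki b i n < b ^ (B b n).+1.
Proof.
move=> n1 B1 ai; have [a [c [Fa Fc Fac acm]]] := B_attained n n1.
have aa := admissible_F_gt0 a Fa.
have [|d [db /dvdzP[t et]]] := exists_digit (i - a%:Z)%R.
  by move=> ob; have := ai ob; have := aa ob; lia.
have [_ _ H] := KiP i n (ltnW n1) ai.
apply: leq_ltn_trans (H (d * b ^ B b n + d + a) _ _) _.
- by rewrite (F_junction_digit _ _ _ _ B1 db acm).
- have /dvdzP[s es] := dvdz_expn_sub1 (B b n); apply/dvdzP; exists (d%:Z * s + t)%R.
  rewrite !PoszD PoszM; move: (b ^ _) es => M es.
  have -> : (M%:Z = s * (b%:Z - 1) + 1)%R by lia.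
  by move: et; rewrite !GRing.mulrDr !GRing.mulrDl !GRing.mulrA; lia.
have mM := linear_expn _ B1; rewrite expnS; nia.
Qed.

Lemma B_step n : 2 < n -> exists i j,
  [/\ admissible i, 1 < j < n, n <= j.*2
    & forall e, Ki b i j.-1 + e * (b - 1) <= Ki b i j -> B b n.-1 + e <= B b n].
Proof.
move=> n2; have [|a [c [Fa Fc Fac acm]]] := B_attained n; first by lia.
wlog ca : a c Fa Fc Fac acm / F b c <= F b a.
  move=> H; have [le|lt] := leqP (F b c) (F b a); first exact: (H a c).
  by apply: (H c a); rewrite ?(ltnW lt) //; lia.
exists (Posz a), (F b a); have aa := admissible_F_gt0 a Fa.
split=> //; [lia|lia|move=> e le].
(* The new element stays in the class of a, so it still pairs with c. *)
have [|Fx xa _] := KiP a (F b a).-1 _ aa; first by lia.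
have [m xcm] := complementary _ _ _ xa (complementary_class _ _ _ acm).
have : B b n.-1 <= m by apply: (B_le _ _ _ _ _ _ xcm); lia.
have := Ki_le a Fa; have b0 : 0 < b - 1 by lia.
by move=> ka Bm; rewrite -(leq_pmul2r b0) mulnDl; nia.
Qed.

(** * Representatives and explicit bounds for n = 1, 2, 3 *)

Lemma exists_class i : admissible i ->
  exists r, I b r /\ (b%:Z - 1 %| r%:Z - i)%Z%R.
Proof.
move=> ai; have := divz_eq i (b%:Z - 1)%R; set t := (_ %/ _)%Z; set r := (_ %% _)%Z => e.
have r0 : (0 <= r)%R by apply: modz_ge0; lia.
have rb : (r < b%:Z - 1)%R by apply: ltz_pmod; lia.
exists `|r|%N; split; last by apply/dvdzP; exists (- t)%R; lia.
split; first by lia.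
move=> ob; have /dvdzP[q iq] := ai ob.
have eb : (b%:Z - 1 = b./2%:Z * 2)%R by lia.
by move: e; rewrite iq eb GRing.mulrA; lia.
Qed.

Lemma Ki_upper i n u : 0 < n -> admissible i -> F b u = n ->
  (b%:Z - 1 %| u%:Z - i)%Z%R -> Ki b i n <= u.
Proof. by move=> n0 ai; have [_ _] := KiP i n n0 ai; apply. Qed.

Lemma F_even_small r : ~~ odd r -> r < b -> F b r = 1.
Proof.
move=> er rb; have -> : r = r./2.*2 by lia.
by apply: F_even => //; [lia|left; lia].
Qed.

(** For odd b this reads K_i(1) <= b - 3, the largest even residue. For even b, one of r and r + b -
    1 is even. *)
Lemma Ki1_le i : admissible i -> Ki b i 1 + (if odd b then b else 0) <= 2 * b - 3.
Proof.
move=> ai; have [r [[/= rb or] ri]] := exists_class i ai.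
case: (boolP (odd r)) => orr.
  have ob : odd b = false by apply/negP => /or; rewrite orr.
  rewrite ob; apply: (@leq_trans (r + (b - 1))); last by lia.
  rewrite addn0; apply: Ki_upper => //.
    have -> : r + (b - 1) = (r + (b - 1))./2.*2 by lia.
    by apply: F_even => //; [lia|right; rewrite ob].
  have -> : ((r + (b - 1))%N%:Z - i = (r%:Z - i) + (b%:Z - 1))%R by lia.
  by rewrite GRing.rpredD // dvdzz.
have : Ki b i 1 <= r by apply: Ki_upper => //; apply: F_even_small => //; lia.
by case: (boolP (odd b)); lia.
Qed.

Lemma B_gt0 n : 1 < n -> 0 < B b n.
Proof. by case/B_attained => a [c [_ _ _]]; case: (B b n) => //; lia. Qed.

(** B(2) = 1 would give a + c + 2 = b - 1, which is odd; but values of [f] below b come from single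
    digits and are even. *)
Lemma B2_even : ~~ odd b -> 1 < B b 2.
Proof.
move=> eb; have := B_gt0 2 isT; have [a [c [Fa Fc _ acm]]] := B_attained 2 isT.
case: (B b 2) acm => // -[|//]; rewrite mul1n => acm _.
have ev x : x < b -> 0 < F b x -> ~~ odd x.
  move=> xb /F_gt0P[v fv]; have vx : v <= x by rewrite -fv leq_addr.
  by move: fv; rewrite /f digit_sum_digit //; lia.
have := ev a _ Fa; have := ev c _ Fc; lia.
Qed.

Lemma F2_odd a : odd b -> ~~ odd a -> a + 2 < b -> F b (b + 1 + a) = 2.
Proof.
move=> ob ea ab; rewrite -{2}(expn1 b) (@F_junction b 1 a (b - 3 - a)) //; last by lia.
by rewrite !F_even_small //; lia.
Qed.

Lemma Ki2_odd_le i : odd b -> admissible i -> Ki b i 2 <= 2 * (b - 1).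
Proof.
move=> ob ai; have [r [[/= rb or] ri]] := exists_class i ai; have er := or ob.
case: (posnP r) => r0.
  apply: Ki_upper => //.
    have -> : 2 * (b - 1) = b + 1 + (b - 3) by lia.
    by apply: F2_odd; lia.
  have -> : ((2 * (b - 1))%N%:Z - i = (r%:Z - i) + (b%:Z - 1) * 2)%R by lia.
  by rewrite GRing.rpredD // dvdz_mulr // dvdzz.
apply: (@leq_trans (b + 1 + (r - 2))); last by lia.
apply: Ki_upper => //; first by apply: F2_odd; lia.
have -> : ((b + 1 + (r - 2))%N%:Z - i = (r%:Z - i) + (b%:Z - 1))%R by lia.
by rewrite GRing.rpredD // dvdzz.
Qed.

(** Junctions at b^2 over the pair (2b - 4, 0) if r = 0, and (r - 2, 2b - 2 - r) otherwise; writing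
    2b - 4 = b + 1 + (b - 5) needs b >= 5. *)
Lemma Ki3_odd_le i : odd b -> 4 < b -> admissible i ->
  Ki b i 3 <= b ^ 2 + 2 * b - 3.
Proof.
move=> ob b4 ai; have [r [[/= rb or] ri]] := exists_class i ai; have er := or ob.
case: (posnP r) => r0.
  have -> : b ^ 2 + 2 * b - 3 = b ^ 2 + 1 + (2 * b - 4) by lia.
  apply: Ki_upper => //.
    rewrite (@F_junction b 2 _ 0) //; last by lia.
    have -> : 2 * b - 4 = b + 1 + (b - 5) by lia.
    by rewrite F2_odd ?F0 //; lia.
  have -> : ((b ^ 2 + 1 + (2 * b - 4))%N%:Z - i
              = (r%:Z - i) + (b%:Z - 1) * (b%:Z + 3))%R by rewrite expnS expn1; lia.
  by rewrite GRing.rpredD // dvdz_mulr // dvdzz.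
apply: (@leq_trans (b ^ 2 + 1 + (r - 2))); last by lia.
apply: Ki_upper => //.
  rewrite (@F_junction b 2 _ (b + 1 + (b - 3 - r))) //; last by lia.
  by rewrite F2_odd ?F_even_small //; lia.
have -> : ((b ^ 2 + 1 + (r - 2))%N%:Z - i
              = (r%:Z - i) + (b%:Z - 1) * (b%:Z + 1))%R by rewrite expnS expn1; lia.
by rewrite GRing.rpredD // dvdz_mulr // dvdzz.
Qed.

(** * Simultaneous growth of [Ki] and [B] *)

Lemma Ki12_step i : admissible i ->
  Ki b i 1 + (if odd b && (b != 3) then 1 else 2) * (b - 1) <= Ki b i 2.
Proof.
move=> ai; have le1 := Ki1_le i ai; have le2 := expn_B_le_Ki i 2 isT ai.
case: (boolP (odd b)) le1 => ob /= le1; last first.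
  have : b ^ 2 <= b ^ B b 2 by rewrite leq_pexp2l ?B2_even //; lia.
  by rewrite expnS expn1; nia.
have le3 : b <= b ^ B b 2 by rewrite -{1}(expn1 b) leq_pexp2l ?B_gt0 //; lia.
(* K_i(1) < b <= K_i(2) are congruent, so they differ by a positive multiple of b - 1; for b = 3,
   K_i(1) = 0 and K_i(2) >= 3 exclude the difference 2. *)
have [_ d1 _] := KiP i 1 isT ai; have [_ d2 _] := KiP i 2 isT ai.
have := GRing.rpredB d2 d1.
have -> : ((Ki b i 2)%:Z - i - ((Ki b i 1)%:Z - i) = (Ki b i 2 - Ki b i 1)%N%:Z)%R by lia.
by rewrite dvdz_base => /dvdnP[t]; case: (b =P 3) => [b3|_] /=; case: t => [|[|t]];
  rewrite ?mulSn /=; lia.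
Qed.

(** The classes are independent because a pair mixes i with -i - 2. Doubling serves the balancing,
    the additive bound the growth of [B]. *)
Definition growing J := forall i i', admissible i -> admissible i' ->
  2 * Ki b i' J.-1 <= Ki b i J /\ Ki b i' J.-1 + 2 * (b - 1) <= Ki b i J.

(* For b = 3, K_0(2) - K_0(1) = 4 = 2 (b - 1), so there is no exception. *)
Definition exceptional n := [&& odd b, b != 3 & (n == 3) || (n == 4)].

(** The larger part j has 2 j >= n, so j = 2, where only [Ki12_step] applies, forces n <= 4. *)
Lemma B_growth_step n : 2 < n -> (forall j, 2 < j < n -> growing j) ->
  B b n.-1 + (if exceptional n then 1 else 2) <= B b n.
Proof.
move=> n2 gr; have [i [j [ai jn nj H]]] := B_step n n2; apply: H.
have [j2|j2] := ltnP 2 j.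
  have [|_] := gr j _ i i ai ai; first by lia.
  by case: (exceptional n); lia.
have -> : j = 2 by lia.
have := Ki12_step i ai; rewrite /exceptional.
have -> : (n == 3) || (n == 4) by lia.
by rewrite andbT.
Qed.

(** If [B] grows by 2, then K_i(n) >= b^(B(n-1)+2) while K_i'(n-1) < b^(B(n-1)+1), a factor b apart.
    Exceptional n use the explicit bounds. *)
Lemma growing_step n : 2 < n -> (forall j, 2 < j < n -> growing j) -> growing n.
Proof.
move=> n2 gr i i' ai ai'.
have Bn := B_growth_step n n2 gr.
have Kn := expn_B_le_Ki i n (ltnW n2) ai.
have Bn1 : 0 < B b n.-1 by apply: B_gt0; lia.
have B3 : 3 < n -> B b 2 + (if exceptional 3 then 1 else 2) <= B b 3.
  by move=> n3; apply: B_growth_step => // j; lia.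
have B20 := B_gt0 2 isT.
have Bprev : 3 < n -> 1 < B b n.-1.
  move=> n3; have : B b n.-1.-1 + (if exceptional n.-1 then 1 else 2) <= B b n.-1.
    by apply: B_growth_step => [|j jn]; [lia|apply: gr; lia].
  have : 0 < B b n.-1.-1 by apply: B_gt0; lia.
  by case: (exceptional _); lia.
case: (boolP (exceptional n)) Bn => ex Bn; last first.
  have Kup : Ki b i' n.-1 < b ^ (B b n.-1).+1.
    have [n3|n3] := ltnP 3 n; first by apply: Ki_lt_expn; [lia|exact: Bprev|].
    have -> : n.-1 = 2 by lia.
    (* [Ki_lt_expn] needs 1 < B(2), known here only for even b; for odd b, K_i'(2) <= 2 (b - 1) <
       b^2 suffices. *)
    case: (boolP (odd b)) => ob; last by apply: Ki_lt_expn => //; exact: B2_even.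
    have := Ki2_odd_le i' ob ai'.
    have : b ^ 2 <= b ^ (B b 2).+1 by rewrite leq_pexp2l //; lia.
    by rewrite expnS expn1; nia.
  have : b ^ (B b n.-1).+2 <= b ^ B b n by rewrite leq_pexp2l //; lia.
  have : b ^ 1 <= b ^ (B b n.-1) by rewrite leq_pexp2l //; lia.
  by rewrite !(expnS b (B b n.-1).+1) !(expnS b (B b n.-1)) expn1 in Kup *; nia.
case/and3P: ex => ob b3 n34; have b4 : 4 < b by lia.
have [n3|n3] := ltnP 3 n.
  have n4 : n = 4 by lia.
  subst n; have := Ki3_odd_le i' ob b4 ai'.
  have : b ^ 3 <= b ^ B b 4.
    by have /= := Bprev isT; rewrite /= in Bn => B1; rewrite leq_pexp2l //; lia.
  by rewrite /= !expnS expn0; nia.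
have n3' : n = 3 by lia.
subst n; have := Ki2_odd_le i' ob ai'.
have : b ^ 2 <= b ^ B b 3 by rewrite /= in Bn; rewrite leq_pexp2l //; lia.
by rewrite /= !expnS expn0; nia.
Qed.

Lemma growingP n : 2 < n -> growing n.
Proof.
elim/ltn_ind: n => n IH n2; apply: growing_step => // j /andP[j2 jn].
exact: IH.
Qed.

Lemma B_growth n : 2 < n -> B b n.-1 + (if exceptional n then 1 else 2) <= B b n.
Proof. by move=> n2; apply: B_growth_step => // j /andP[j2 _]; exact: growingP. Qed.

(** * Optimality of the balanced pair *)

Lemma Ki_double_le i i' j n : 1 < j -> j < n -> admissible i -> admissible i' ->
  2 * Ki b i' j <= Ki b i n.
Proof.
move=> j1 jn ai ai'; elim: n jn i ai => // n IH jn i ai.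
have [g _] : _ /\ _ := growingP n.+1 (leq_ltn_trans j1 jn) i i' ai ai'.
have [jn'|jn'] := ltnP j n; last by have -> : j = n by lia.
by have := IH jn' i' ai'; move: g; rewrite /=; lia.
Qed.

(** K_i(J) is at least twice each term on the left, hence at least their sum; n > 3 keeps both parts
    above 1, as doubling requires. *)
Lemma balanced_le i i' n J : 3 < n -> uphalf n < J < n ->
  admissible i -> admissible i' ->
  Ki b i (uphalf n) + Ki b i' n./2 <= Ki b i J.
Proof.
move=> n3 Jn ai ai'.
have := Ki_double_le i i (uphalf n) J; have := Ki_double_le i i' n./2 J.
by move=> H1 H2; have := H1 _ _ ai ai'; have := H2 _ _ ai ai; lia.
Qed.

Lemma K'_le i n j : 1 < n -> 0 < j < n -> admissible i ->
  K' b i n <= Ki b i j + Ki b (- i - 2)%R (n - j).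
Proof.
move=> n1 jn ai; have ai' := admissible_opp i ai; rewrite /K' geq_min.
have [le|lt] := leqP j (uphalf n); last first.
  apply/orP; left; have := balanced_le i _ n j _ _ ai ai'; lia.
have [le'|lt'] := leqP (n - j) (uphalf n); last first.
  apply/orP; right; have := balanced_le _ i n (n - j) _ _ ai' ai; lia.
have [->|jn'] := eqVneq j (uphalf n).
  by rewrite (_ : n - uphalf n = n./2) ?leqnn //; lia.
have -> : j = n./2 by lia.
have -> : n - n./2 = uphalf n by lia.
by rewrite leqnn orbT.
Qed.

Lemma K'_attained i n : 1 < n -> exists j,
  0 < j < n /\ K' b i n = Ki b i j + Ki b (- i - 2)%R (n - j).
Proof.
move=> n1; rewrite /K' /minn; case: ifP => _.
  have e : n - uphalf n = n./2 by lia.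
  by exists (uphalf n); rewrite e; split=> //; lia.
have e : n - n./2 = uphalf n by lia.
by exists n./2; rewrite e; split=> //; lia.
Qed.

(** * The formula for [B] and the conclusion *)

Lemma nat_min_eq (A : set nat) m : A m -> (forall v, A v -> m <= v) -> nat_min A = m.
Proof.
move=> Am minm; have [Ax minx] := nat_minP (ex_intro _ m Am).
by apply/eqP; rewrite eqn_leq minx // minm.
Qed.

Lemma B_eq n : 1 < n ->
  nat_min [set K' b i%:Z n | i in I b] + 2 = B b n * (b - 1).
Proof.
move=> n1; have [x Ix] := exists_I b1.
have [|[i Ii <-] mini] := @nat_minP [set K' b i%:Z n | i in I b].
  by exists (K' b x%:Z n), x.
have ai := admissible_I i Ii; have ai' := admissible_opp i ai.
have [j [jn K'E]] := K'_attained i%:Z n n1.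
apply/eqP; rewrite eqn_leq; apply/andP; split; last first.
  (* The minimizing pair is a junction pair, so its exponent m is at least B(n). *)
  have [|Fa da _] := KiP i j _ ai; first by lia.
  have [|Fc dc _] := KiP (- i%:Z - 2)%R (n - j) _ ai'; first by lia.
  have [m acm] := complementary _ _ _ da dc.
  rewrite K'E acm leq_mul2r; apply/orP; right; apply: (B_le _ _ _ _ n1 _ acm).
  by rewrite Fa Fc; lia.
(* Conversely, an optimal pair a, c dominates the least elements of its classes, with a reduced to r
   in [I]. *)
have [a [c [Fa Fc Fac acm]]] := B_attained n n1.
have aa := admissible_F_gt0 a Fa.
have [r [Ir ra]] := exists_class a aa.
have : K' b r n <= a + c; last first.
  by have := mini (K' b r n) (ex_intro2 _ _ r Ir erefl); lia.
apply: leq_trans (K'_le r n (F b a) n1 _ (admissible_I r Ir)) _; first by lia.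
have -> : n - F b a = F b c by lia.
rewrite (Ki_class _ _ _ ra) leq_add ?Ki_le //.
rewrite (@Ki_class _ (Posz c)) ?Ki_le //.
have dc := complementary_class _ _ _ acm.
have -> : (- r%:Z - 2 - c%:Z = - ((r%:Z - a%:Z) + (c%:Z - (- a%:Z - 2))))%R by lia.
by rewrite GRing.rpredN GRing.rpredD.
Qed.

End Junctions.

Theorem theorem6p1 (b : nat) (hb : 2 <= b) :
  (forall n : nat, 2 <= n ->
    (forall i : nat, I b i ->
      nat_min [set Ki b i%:Z j + Ki b (- i%:Z - 2)%R (n - j)
               | j in [set j | 1 <= j <= n - 1]]
      = K' b i%:Z n)
    /\ ((B b n)%:R = Bhat b n)%R) /\
  (forall n : nat, 3 <= n ->
    if odd b && ((n == 3) || (n == 4))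
    then B b (n - 1) + 1 <= B b n
    else B b (n - 1) + 2 <= B b n).
Proof.
split=> [n n1|n n2].
  split=> [i Ii|].
    have [j [jn K'E]] := K'_attained b hb i n n1.
    apply: nat_min_eq => [|_ [k kn <-]]; first by exists j => //=; lia.
    by apply: K'_le => //; [rewrite /= in kn; lia|exact: (admissible_I b hb)].
  have b0 : ((b - 1)%N%:R != 0 :> rat)%R by rewrite Num.Theory.pnatr_eq0; lia.
  by rewrite /Bhat B_eq // GRing.natrM GRing.mulfK.
(* For b = 3 this gives growth 2 also at n = 3, 4, more than claimed. *)
have := B_growth b hb n n2; rewrite subn1 /exceptional.
by case: (odd b); case: (b != 3); case: (_ || _) => /=; lia.
Qed.
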